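(* Let $L>0$, $\mu\in(-\infty,0)$, $\kappa:=\mu/L$, let $N$ be a positive integer and let $\gamma L\in[\overline{\gamma L}_{N-1}(\kappa),\overline{\gamma L}_N(\kappa))$, such that $\bar N(\gamma L,\kappa)=N-1$. Then there exist $x_0$ and $f\in\mathcal{F}_{\mu,L}$ such that after applying $N$ iterations of gradient descent $x_{i+1}=x_i-\gamma\nabla f(x_i)$, $i=0,\dots,N-1$, on the function $f$ with constant stepsize $\gamma$ (normalized stepsize $\gamma L$), starting from $x_0$, the performance bound for weakly convex functions (recalled in the context) holds exactly, i.e. with equality: $$\frac1{2L}\min_{0\le i\le N}\{\|\nabla f(x_i)\|^2\}=\frac{f(x_0)-f_*}{1+\gamma L\ \dfrac{\frac{(1-\gamma L)^2E_N(1-\gamma L)}{1-(1-\gamma L)^2}-\frac{(1-\gamma\mu)^2E_N(1-\gamma\mu)}{1-(1-\gamma\mu)^2}}{\frac1{1-(1-\gamma L)^2}-\frac1{1-(1-\gamma\mu)^2}}}.$$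
   Context: For $L\in(0,\infty)$ and $\mu\in(-\infty,L)$, $\mathcal{F}_{\mu,L}$ is the class of functions $f:\mathbb{R}^d\to\mathbb{R}$ such that both $\frac{L}{2}\|\cdot\|^2-f$ and $f-\frac{\mu}{2}\|\cdot\|^2$ are convex ($\|\cdot\|$ is the Euclidean norm; such functions are differentiable). Functions $f$ are assumed bounded below, and $f_*:=\inf_x f(x)>-\infty$. For an integer $k\ge1$ let $E_k(x):=\sum_{j=1}^{2k}x^{-j}$ for $x\in\mathbb{R}\setminus\{0\}$ and, for $\kappa<0$ and $\ell\in(1,2)$, $T_k(\ell,\kappa):=E_k(1-\kappa\ell)-E_k(1-\ell)$ (with $T_0:=0$, the empty sum). For $\kappa<0$, $\overline{\gamma L}_0(\kappa):=1$ and, for $k\ge1$, $\overline{\gamma L}_k(\kappa)$ is the unique root $\ell\in(1,2)$ of $T_k(\ell,\kappa)=0$; these thresholds are increasing in $k$. Further, $\bar N(\gamma L,\kappa):=\max\{k\in\mathbb{N}: T_k(\gamma L,\kappa)\ge0\}$. The performance bound for weakly convex functions is, for every $f\in\mathcal{F}_{\mu,L}$ with $\mu<0$ and constant stepsize $\gamma L\in(0,2)$, $$\frac1{2L}\min_{0\le i\le N}\{\|\nabla f(x_i)\|^2\}\le\frac{f(x_0)-f_*}{1+\gamma L\,\min\big\{P_N(\gamma L,\gamma\mu),\ \frac{-1+(1-\gamma L)^{-2N}}{\gamma L}\big\}},$$ where $$P_N(l,u):=p(l,u)\bigg[N-\frac{-lu}{l-u}\sum_{k=1}^N\Big[\frac{-1+(1-u)^{-2k}}{u}-\frac{-1+(1-l)^{-2k}}{l}\Big]_+\bigg],\qquad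 p(l,u):=2-\frac{-lu}{1-u-|1-l|},$$ $[x]_+:=\max\{x,0\}$, and every term $[\cdot]_+$ is zero when $l\in(0,1]$. *)

(* Defs.v *)
From mathcomp Require Import all_boot all_order all_algebra.
From mathcomp Require Import all_classical all_reals all_analysis.

Set Implicit Arguments.
Unset Strict Implicit.
Unset Printing Implicit Defensive.

Import Order.TTheory GRing.Theory Num.Theory.
Import numFieldNormedType.Exports.

Local Open Scope classical_set_scope.
Local Open Scope ring_scope.

(* Squared Euclidean norm; the library norm `|x| on 'rV[R]_d is the sup norm. *)
Definition sqnorm2 (R : realType) (d : nat) (x : 'rV[R]_d) : R :=
  \sum_(i < d) x 0 i ^+ 2.

Definition weakly_convex_smooth (R : realType) (d : nat) (mu L : R)
    (f : 'rV[R]_d -> R) : Prop :=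
  convex_function (setT : set (convex_lmodType 'rV[R]_d))
    (fun x => L / 2 * sqnorm2 x - f x) /\
  convex_function (setT : set (convex_lmodType 'rV[R]_d))
    (fun x => f x - mu / 2 * sqnorm2 x).

(* The vector of partial derivatives, which is the gradient because it is only
   applied to differentiable functions (those of the class above). *)
Definition gradient (R : realType) (d : nat) (f : 'rV[R]_d -> R)
    (x : 'rV[R]_d) : 'rV[R]_d :=
  \row_(i < d) 'D_(delta_mx 0 i) f x.

Definition gd_iter (R : realType) (d : nat) (f : 'rV[R]_d -> R) (gamma : R)
    (x0 : 'rV[R]_d) (i : nat) : 'rV[R]_d :=
  iter i (fun x => x - gamma *: gradient f x) x0.

Definition min_sqgrad (R : realType) (d : nat) (f : 'rV[R]_d -> R) (gamma : R)
    (x0 : 'rV[R]_d) (N : nat) : R :=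
  \big[Num.min/sqnorm2 (gradient f x0)]_(i < N.+1)
    sqnorm2 (gradient f (gd_iter f gamma x0 i)).

Definition E_sum (R : realType) (k : nat) (x : R) : R :=
  \sum_(1 <= j < (2 * k)%N.+1) x ^- j.

(* x ^ 2 * E_k(x) as a Laurent polynomial. It agrees with the product for
   x != 0, and for k = 1 it is x + 1, hence also meaningful at x = 0 (the case
   of normalized stepsize 1), where E_k itself is undefined. *)
Definition sqE_sum (R : realType) (k : nat) (x : R) : R :=
  \sum_(1 <= j < (2 * k)%N.+1) x ^ (2 - j%:Z).

Lemma sqE_sumE (R : realType) (k : nat) (x : R) :
  x != 0 -> sqE_sum k x = x ^+ 2 * E_sum k x.
Proof.
move=> x0; rewrite /sqE_sum /E_sum big_distrr /=.
by apply: eq_bigr => j _; rewrite expfzDr // -exprnP exprnN.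
Qed.

Lemma sqE_sum1 (R : realType) (x : R) : sqE_sum 1 x = x + 1.
Proof. by rewrite /sqE_sum muln1 big_nat_recl // big_nat1. Qed.

Definition T_diff (R : realType) (k : nat) (l kappa : R) : R :=
  E_sum k (1 - kappa * l) - E_sum k (1 - l).

Definition threshold (R : realType) (k : nat) (kappa : R) : R :=
  if k == 0%N then 1
  else xget 1 [set l : R | 1 < l < 2 /\ T_diff k l kappa = 0].

(* For k > 0, T_k(l, kappa) tends to -oo as l decreases to 1, so at l = 1, where
   E_k(1 - l) is undefined, T_k is not counted as nonnegative. *)
Definition T_nonneg (R : realType) (k : nat) (l kappa : R) : Prop :=
  k = 0%N \/ (l != 1 /\ 0 <= T_diff k l kappa).

Definition is_Nbar (R : realType) (l kappa : R) (M : nat) : Prop :=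
  T_nonneg M l kappa /\ (forall k, T_nonneg k l kappa -> (k <= M)%N).

Definition p_coef (R : realType) (l u : R) : R :=
  2 - (- l * u) / (1 - u - `|1 - l|).

(* For u < 0 the difference is negative when 0 < l < 1, and at l = 1 it is -oo
   since (1 - l) ^- (2 * k) stands for +oo there. *)
Definition P_term (R : realType) (k : nat) (l u : R) : R :=
  if l <= 1 then 0
  else Num.max 0
    ((-1 + (1 - u) ^- (2 * k)%N) / u - (-1 + (1 - l) ^- (2 * k)%N) / l).

Definition P_rate (R : realType) (N : nat) (l u : R) : R :=
  p_coef l u *
    (N%:R - (- l * u) / (l - u) * \sum_(1 <= k < N.+1) P_term k l u).

(* At l = 1 the second argument of the minimum is +oo. *)
Definition weakly_convex_rate (R : realType) (N : nat) (l u : R) : R :=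
  if l == 1 then P_rate N l u
  else Num.min (P_rate N l u) ((-1 + (1 - l) ^- (2 * N)%N) / l).

Definition tight_rate (R : realType) (N : nat) (l u : R) : R :=
  (sqE_sum N (1 - l) / (1 - (1 - l) ^+ 2)
   - sqE_sum N (1 - u) / (1 - (1 - u) ^+ 2))
  / (1 / (1 - (1 - l) ^+ 2) - 1 / (1 - (1 - u) ^+ 2)).

(* Main.v *)
Require Import Defs.
From mathcomp Require Import all_boot all_order all_algebra.
From mathcomp Require Import all_classical all_reals all_analysis.
From mathcomp Require Import ring lra zify.
Import Order.TTheory GRing.Theory Num.Theory.
Import numFieldNormedType.Exports.
Local Open Scope classical_set_scope.
Local Open Scope ring_scope.

(** Write [l = gamma L], [u = gamma mu], [x = 1 - l] in (-1, 0] and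
    [y = 1 - u > 1], and consider a function that is separable in two
    coordinates, with curvature [L] along the first and curvature [mu] along
    the second. Gradient descent multiplies the two components of the gradient
    by [x] and [y] at each step, so the squared gradient norm at step [i] is
    [A x^2i + B y^2i], a convex sequence in [i]. Choosing [A : B] so that the
    values at steps [N - 1] and [N] coincide makes the sequence nonincreasing
    up to [N], and its minimum is its value at [N] ([energy_ge]). The tight
    rate is the barycentre of [E_N x] and [E_N y] for the corresponding
    weights.

    The curvature [mu < 0] along the second coordinate makes this quadratic
    unbounded below. It is repaired by switching to curvature [L] beyond the
    last iterate [c], symmetrically on both sides ([well]). No iterate sees the
    change, and the infimum becomes [f x_N - |grad f x_N|^2 / (2 L)], the
    largest infimum an [L]-smooth function with these data can have. The
    resulting function ([valley]) then attains the tight rate by a rational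
    identity ([tight_value]). Membership in the class and the value of the
    gradient both come from one two-sided quadratic estimate around every point
    ([curvature_between]).

    For the piecewise form of the bound, the differences [E_k y - E_k x] are
    partial sums of a decreasing sequence, so the condition on [Nbar] says that
    they are nonnegative for [k < N] and negative for [k = N]. This resolves
    every positive part, and the geometric sums collapse to the tight rate
    ([P_rate_tight]); the second branch of the minimum is not smaller because
    the tight rate averages [E_N x] with the smaller [E_N y]
    ([tight_rate_le_E_sum]).

    In dimension one a constant function gives equality, both sides being
    zero. *)

(** * Two-sided quadratic estimates *)

Definition dotp {R : realType} {d : nat} (u v : 'rV[R]_d) : R :=
  \sum_(i < d) u 0 i * v 0 i.

Lemma sqnorm2B (R : realType) (d : nat) (x y : 'rV[R]_d) :
  sqnorm2 (y - x) = sqnorm2 y - sqnorm2 x - 2 * dotp x (y - x).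
Proof.
rewrite /sqnorm2 /dotp mulr_sumr -!sumrB; apply: eq_bigr => i _.
rewrite !mxE; ring.
Qed.

(** A function with a supporting hyperplane at every point is convex: average
    the two inequalities based at the convex combination itself. *)
Lemma convex_supporting (R : realType) (d : nat) (f : 'rV[R]_d -> R)
    (s : 'rV[R]_d -> 'rV[R]_d) :
  (forall x y, f x + dotp (s x) (y - x) <= f y) ->
  convex_function (setT : set (convex_lmodType 'rV[R]_d)) f.
Proof.
move=> hs t x y _ _.
have t0 : 0 <= t%:num by [].
have t1 : 0 <= 1 - t%:num by rewrite subr_ge0.
rewrite convRE.
set p : 'rV[R]_d := conv t x y.
have pE : p = t%:num *: (x : 'rV[R]_d) + (1 - t%:num) *: (y : 'rV[R]_d) by [].
have hx := ler_wpM2l t0 (hs p x); have hy := ler_wpM2l t1 (hs p y).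
have dot0 : t%:num * dotp (s p) ((x : 'rV[R]_d) - p) +
    (1 - t%:num) * dotp (s p) ((y : 'rV[R]_d) - p) = 0.
  rewrite /dotp !mulr_sumr -big_split /= big1 // => i _.
  rewrite pE !mxE; ring.
apply: le_trans (lerD hx hy); rewrite !mulrDr addrACA dot0 addr0 -mulrDl.
by rewrite addrC subrK mul1r.
Qed.

(** The slope [s] is carried along with [f] so that the same hypothesis yields
    convexity of both shifted functions and identifies the gradient. *)
Definition curvature_between {R : realType} {d : nat} (mu L : R)
    (f : 'rV[R]_d -> R) (s : 'rV[R]_d -> 'rV[R]_d) : Prop :=
  forall x y, mu / 2 * sqnorm2 (y - x) <= f y - f x - dotp (s x) (y - x) /\
              f y - f x - dotp (s x) (y - x) <= L / 2 * sqnorm2 (y - x).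

Lemma dotpDZl (R : realType) (d : nat) (a b : R) (u v w : 'rV[R]_d) :
  dotp (a *: u + b *: v) w = a * dotp u w + b * dotp v w.
Proof.
rewrite /dotp !mulr_sumr -big_split; apply: eq_bigr => i _ /=.
rewrite !mxE; ring.
Qed.

Lemma weakly_convex_smooth_curvature (R : realType) (d : nat) (mu L : R)
    (f : 'rV[R]_d -> R) (s : 'rV[R]_d -> 'rV[R]_d) :
  curvature_between mu L f s -> weakly_convex_smooth mu L f.
Proof.
move=> hf; split.
  apply: (@convex_supporting R d _ (fun x => L *: x + (-1) *: s x)) => x y.
  have [_] := hf x y; rewrite dotpDZl sqnorm2B; lra.
apply: (@convex_supporting R d _ (fun x => 1 *: s x + (- mu) *: x)) => x y.
have [+ _] := hf x y; rewrite dotpDZl sqnorm2B; lra.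
Qed.

(** Along a coordinate axis the difference quotient differs from the slope by
    at most a constant times the step. *)
Lemma gradient_curvature (R : realType) (d : nat) (mu L : R)
    (f : 'rV[R]_d -> R) (s : 'rV[R]_d -> 'rV[R]_d) (x : 'rV[R]_d) :
  curvature_between mu L f s -> gradient f x = s x.
Proof.
move=> hf; apply/rowP => i; rewrite mxE.
set e := delta_mx 0 i.
have dote t : dotp (s x) (t *: e) = t * s x 0 i.
  rewrite /dotp (bigD1 i) //= big1 ?addr0 => [|j ji].
    by rewrite !mxE !eqxx mulr1 mulrC.
  by rewrite !mxE eqxx (negPf ji) !mulr0.
have sqe t : sqnorm2 (t *: e) = t ^+ 2.
  rewrite /sqnorm2 (bigD1 i) //= big1 ?addr0 => [|j ji].
    by rewrite !mxE !eqxx mulr1.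
  by rewrite !mxE eqxx (negPf ji) mulr0 expr0n.
rewrite /derive; apply: cvg_lim => //.
set C := `|mu| + `|L|.
have C0 : 0 <= C by rewrite addr_ge0.
have key (t : R) : t != 0 ->
    `|t^-1 *: ((f \o shift x) (t *: e) - f x) - s x 0 i| <= C * `|t|.
  move=> t0; have := hf x (t *: e + x); rewrite addrK dote sqe /= => -[h1 h2].
  have -> : t^-1 *: (f (t *: e + x) - f x) - s x 0 i =
      t^-1 * (f (t *: e + x) - f x - t * s x 0 i).
    by rewrite mulrBr mulKf.
  rewrite normrM normfV ler_pdivrMl ?normr_gt0 // mulrCA -expr2.
  rewrite real_normK ?num_real //.
  have hmu : - `|mu| <= mu <= `|mu| by rewrite -ler_norml.
  have hL : - `|L| <= L <= `|L| by rewrite -ler_norml.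
  have t2 := sqr_ge0 t.
  case/andP: hmu => m1 m2; case/andP: hL => l1 l2.
  have p1 := normr_ge0 mu; have p2 := normr_ge0 L.
  rewrite ler_norml; apply/andP; split.
    apply: le_trans h1; rewrite /C -mulNr ler_wpM2r //; lra.
  apply: (le_trans h2); rewrite /C ler_wpM2r //; lra.
apply/cvgrPdist_le => eps eps0.
have C1 : 0 < C + 1 by rewrite ltr_wpDl.
near=> t.
have t0 : t != 0 by near: t; exact: nbhs_dnbhs_neq.
rewrite distrC (le_trans (key t t0)) //.
apply: (@le_trans _ _ ((C + 1) * `|t|)).
  by rewrite ler_wpM2r // lerDl.
rewrite mulrC -ler_pdivlMr // ltW //.
near: t; apply: dnbhs0_lt; exact: divr_gt0.
Unshelve. all: by end_near.
Qed.

(** * The one-dimensional well *)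

Definition clip {R : realType} (c z : R) : R := Num.max (- c) (Num.min c z).

Definition overshoot {R : realType} (c z : R) : R := z - clip c z.

Lemma clip_itv (R : realType) (c z : R) : 0 <= c -> - c <= clip c z <= c.
Proof.
move=> c0; rewrite /clip le_max lexx /= ge_max ge_min lexx /= andbT.
by rewrite ge0_cp.
Qed.

Lemma clip_id (R : realType) (c z : R) : - c <= z <= c -> clip c z = z.
Proof. by case/andP=> h1 h2; rewrite /clip min_r // max_r. Qed.

Lemma clip_ge (R : realType) (c z : R) : 0 <= c -> c <= z -> clip c z = c.
Proof. by move=> c0 cz; rewrite /clip min_l // max_r // ge0_cp. Qed.

(** The variational characterization of the projection onto [[-c, c]]. *)
Lemma clip_obtuse (R : realType) (c z q : R) :
  - c <= q <= c -> overshoot c z * (q - clip c z) <= 0.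
Proof.
case/andP=> h1 h2; rewrite /overshoot /clip.
by case: (leP c z) => h3; case: (leP (- c) _) => h4; nra.
Qed.

(** Curvature [mu] on [[-c, c]], curvature [L] outside, continuously
    differentiable at the junctions. Writing it with the squared distance to
    the interval avoids case distinctions on the position of [z]. *)
Definition well {R : realType} (mu L c z : R) : R :=
  mu / 2 * z ^+ 2 + (L - mu) / 2 * overshoot c z ^+ 2.

Definition well_slope {R : realType} (mu L c z : R) : R :=
  mu * z + (L - mu) * overshoot c z.

(** Both gaps are [(L - mu) / 2] times a square plus an obtuse-angle product:
    the squared distance to the interval and its complement in [z ^+ 2] (a
    Huber function) are both convex. *)
Lemma well_curvature (R : realType) (mu L c x y : R) :
  0 <= c -> mu <= L ->
  mu / 2 * (y - x) ^+ 2 <=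
    well mu L c y - well mu L c x - well_slope mu L c x * (y - x) /\
  well mu L c y - well mu L c x - well_slope mu L c x * (y - x) <=
    L / 2 * (y - x) ^+ 2.
Proof.
move=> c0 muL.
have hx := clip_obtuse R c x (clip c y) (clip_itv R c y c0).
have hy := clip_obtuse R c y (clip c x) (clip_itv R c x c0).
move: hx hy; rewrite /well /well_slope /overshoot.
set p := clip c x; set q := clip c y => hx hy.
have D0 : 0 <= L - mu by rewrite subr_ge0.
split; rewrite -subr_ge0.
  rewrite (_ : _ - _ = (L - mu) / 2 * (((y - q) - (x - p)) ^+ 2
    - 2 * ((x - p) * (q - p)))); last by field.
  have s := sqr_ge0 (y - q - (x - p)).
  by rewrite mulr_ge0 ?divr_ge0 //; lra.
rewrite (_ : _ - _ = (L - mu) / 2 * ((q - p) ^+ 2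
    - 2 * ((y - q) * (p - q)))); last by field.
have s := sqr_ge0 (q - p).
by rewrite mulr_ge0 ?divr_ge0 //; lra.
Qed.

Lemma well_inside (R : realType) (mu L c z : R) : - c <= z <= c ->
  well mu L c z = mu / 2 * z ^+ 2.
Proof.
by move=> hz; rewrite /well /overshoot clip_id // subrr expr0n mulr0 addr0.
Qed.

Lemma well_slope_inside (R : realType) (mu L c z : R) : - c <= z <= c ->
  well_slope mu L c z = mu * z.
Proof.
by move=> hz; rewrite /well_slope /overshoot clip_id // subrr mulr0 addr0.
Qed.

Definition well_min {R : realType} (mu L c : R) : R :=
  mu / 2 * c ^+ 2 - (mu * c) ^+ 2 / (2 * L).

(** The minimizer is one gradient step of length [1 / L] away from [c]. *)
Lemma well_min_attained (R : realType) (mu L c : R) :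
  0 < L -> mu <= 0 -> 0 <= c ->
  well mu L c (c - mu * c / L) = well_min mu L c.
Proof.
move=> L0 mu0 c0; rewrite /well /overshoot clip_ge //.
  by rewrite /well_min; field; rewrite gt_eqF.
by rewrite lerDl oppr_ge0 mulr_le0_ge0 ?invr_ge0 ?(ltW L0) // mulr_le0_ge0.
Qed.

(** Complete the square in the overshoot, then bound the clipped point by [c]. *)
Lemma well_min_le (R : realType) (mu L c z : R) :
  0 < L -> mu <= 0 -> 0 <= c ->
  well_min mu L c <= well mu L c z.
Proof.
move=> L0 mu0 c0; case/andP: (clip_itv R c z c0) => h1 h2.
rewrite /well_min /well /overshoot; set p := clip c z in h1 h2 *.
have Ln : L != 0 by rewrite gt_eqF.
rewrite -subr_ge0 (_ : _ - _ = L / 2 * (z - p + mu * p / L) ^+ 2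
   + (- mu) * (L - mu) / (2 * L) * ((c - p) * (c + p))); last by field.
apply: addr_ge0; first by rewrite mulr_ge0 ?sqr_ge0 // divr_ge0 // ltW.
apply: mulr_ge0; last by apply: mulr_ge0; lra.
by rewrite divr_ge0 ?mulr_ge0 //; lra.
Qed.

(** * The function on the plane *)

(** All coordinates after the first two vanish, so the construction lives in a
    plane of the ambient space. *)
Definition plane_vec {R : realType} {d : nat} (a b : R) : 'rV[R]_d.+2 :=
  \row_i (if i == ord0 then a else if i == lift ord0 ord0 then b else 0).

Lemma sqnorm2_plane (R : realType) (d : nat) (a b : R) :
  sqnorm2 (plane_vec a b : 'rV[R]_d.+2) = a ^+ 2 + b ^+ 2.
Proof.
rewrite /sqnorm2 !big_ord_recl !mxE /= big1 ?addr0 // => i _.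
by rewrite mxE /= expr0n.
Qed.

Lemma dotp_plane (R : realType) (d : nat) (a b : R) (v : 'rV[R]_d.+2) :
  dotp (plane_vec a b) v = a * v 0 ord0 + b * v 0 (lift ord0 ord0).
Proof.
rewrite /dotp !big_ord_recl !mxE /= big1 ?addr0 // => i _.
by rewrite mxE /= mul0r.
Qed.

Definition valley {R : realType} {d : nat} (mu L c : R) (v : 'rV[R]_d.+2) : R :=
  L / 2 * v 0 ord0 ^+ 2 + well mu L c (v 0 (lift ord0 ord0)).

Definition valley_slope {R : realType} {d : nat} (mu L c : R)
    (v : 'rV[R]_d.+2) : 'rV[R]_d.+2 :=
  plane_vec (L * v 0 ord0) (well_slope mu L c (v 0 (lift ord0 ord0))).

Lemma valley_curvature (R : realType) (d : nat) (mu L c : R) :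
  0 <= L -> mu <= 0 -> 0 <= c ->
  curvature_between mu L (valley mu L c : 'rV[R]_d.+2 -> R)
    (valley_slope mu L c).
Proof.
move=> L0 mu0 c0 x y.
rewrite dotp_plane /valley /sqnorm2 !big_ord_recl !mxE.
set S := \sum_(i < d) _.
have S0 : 0 <= S by apply: sumr_ge0 => i _; exact: sqr_ge0.
have := @well_curvature R mu L c (x 0 (lift ord0 ord0))
  (y 0 (lift ord0 ord0)) c0 (le_trans mu0 L0).
set x1 := x 0 (lift _ _); set y1 := y 0 (lift _ _).
set x0 := x 0 ord0; set y0 := y 0 ord0.
have t0 := sqr_ge0 (y0 - x0).
have m1 := mulr_le0_ge0 mu0 S0; have m2 := mulr_ge0 L0 S0.
have m3 := mulr_le0_ge0 mu0 t0; have m4 := mulr_ge0 L0 t0.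
by move=> [h1 h2]; split; lra.
Qed.

Lemma inf_attained (R : realType) (T : Type) (f : T -> R) (z : T) :
  (forall x, f z <= f x) -> has_lbound (range f) /\ inf (range f) = f z.
Proof.
move=> hz; have lb : lbound (range f) (f z) by move=> _ [x _ <-].
have hl : has_lbound (range f) by exists (f z).
split=> //; apply/eqP; rewrite eq_le; apply/andP; split.
  by apply: ge_inf => //; exists z.
by apply: lb_le_inf => //; exists (f z), z.
Qed.

Lemma valley_inf (R : realType) (d : nat) (mu L c : R) :
  0 < L -> mu <= 0 -> 0 <= c ->
  has_lbound (range (valley mu L c : 'rV[R]_d.+2 -> R)) /\
  inf (range (valley mu L c : 'rV[R]_d.+2 -> R)) = well_min mu L c.
Proof.
move=> L0 mu0 c0.
have z : valley mu L c (plane_vec 0 (c - mu * c / L) : 'rV[R]_d.+2) =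
    well_min mu L c.
  by rewrite /valley !mxE /= well_min_attained // expr0n mulr0 add0r.
rewrite -z; apply: inf_attained => v; rewrite z.
apply: (le_trans (well_min_le R mu L c (v 0 (lift ord0 ord0)) L0 mu0 c0)).
by rewrite /valley lerDr mulr_ge0 ?divr_ge0 ?sqr_ge0 // ltW.
Qed.

(** As long as the second coordinate stays within [c], the second component of
    the slope is linear, so each step scales the two coordinates
    independently. *)
Lemma gd_iter_valley (R : realType) (d : nat) (mu L gamma c a b : R) (n : nat) :
  0 < L -> mu <= 0 -> 0 <= gamma -> 0 <= b ->
  (1 - gamma * mu) ^+ n * b <= c ->
  forall i, (i <= n)%N ->
  gd_iter (valley mu L c : 'rV[R]_d.+2 -> R) gamma (plane_vec a b) i =
    plane_vec ((1 - gamma * L) ^+ i * a) ((1 - gamma * mu) ^+ i * b) /\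
  gradient (valley mu L c) (plane_vec ((1 - gamma * L) ^+ i * a)
     ((1 - gamma * mu) ^+ i * b) : 'rV[R]_d.+2) =
    plane_vec (L * ((1 - gamma * L) ^+ i * a))
      (mu * ((1 - gamma * mu) ^+ i * b)).
Proof.
move=> L0 mu0 g0 b0 hc i.
have y1 : 1 <= 1 - gamma * mu by rewrite lerDl oppr_ge0 mulr_ge0_le0.
have yi j : 0 <= (1 - gamma * mu) ^+ j * b.
  by rewrite mulr_ge0 // exprn_ge0 // (le_trans ler01).
have c0 : 0 <= c := le_trans (yi n) hc.
have grad j : (j <= n)%N -> gradient (valley mu L c)
     (plane_vec ((1 - gamma * L) ^+ j * a)
        ((1 - gamma * mu) ^+ j * b) : 'rV[R]_d.+2) =
    plane_vec (L * ((1 - gamma * L) ^+ j * a))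
      (mu * ((1 - gamma * mu) ^+ j * b)).
  move=> jn; rewrite (gradient_curvature _ _ _ _ _ _ _
    (valley_curvature R d mu L c (ltW L0) mu0 c0)).
  rewrite /valley_slope !mxE /= well_slope_inside //.
  (* The second coordinate grows with [j], so the bound at [n] covers all. *)
  have h : (1 - gamma * mu) ^+ j * b <= c.
    by apply: le_trans hc; rewrite ler_wpM2r // ler_weXn2l.
  by rewrite h (le_trans _ (yi j)) // oppr_le0.
elim: i => [|i IH] lin; first by rewrite -(grad 0%N) // !expr0 !mul1r.
split; last exact: grad.
rewrite /gd_iter iterS -/(gd_iter _ _ _ _) (IH (ltnW lin)).1 grad 1?ltnW //.
apply/rowP => k; rewrite !mxE !exprS.
by case: ifP => _; [|case: ifP => _]; ring.
Qed.

(** * Sums of inverse powers and the rates *)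

(** The default value [1] chosen for a missing root also lies in this range. *)
Lemma threshold_itv (R : realType) (k : nat) (kappa : R) :
  1 <= threshold k kappa < 2.
Proof.
rewrite /threshold; case: ifP => _; first by rewrite lexx ltr1n.
by case: xgetP => [l _ /= [/andP[/ltW -> ->]] //|_]; rewrite lexx ltr1n.
Qed.

Lemma E_sum0 (R : realType) (z : R) : E_sum 0 z = 0.
Proof. by rewrite /E_sum muln0 big_geq. Qed.

(** Two consecutive inverse powers are grouped: for [-1 < z] every such pair is
    nonnegative, and the pairs form a geometric progression. *)
Lemma E_sumS (R : realType) (k : nat) (z : R) : z != 0 ->
  E_sum k.+1 z = E_sum k z + (1 + z) * (z ^+ 2)^-1 ^+ k.+1.
Proof.
move=> z0; rewrite /E_sum mulnS add2n big_nat_recr // big_nat_recr //= -addrA.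
congr (_ + _); rewrite exprVn -exprM mulnS add2n !exprS.
have pair (t : R) : t != 0 ->
    (z * t)^-1 + (z * (z * t))^-1 = (1 + z) / (z * (z * t)).
  by move=> t0; field; rewrite z0 t0.
by apply: pair; rewrite expf_neq0.
Qed.

(** For [k = 0] this also holds at [z = 0], which covers the normalized stepsize
    one. *)
Lemma E_sum_closed (R : realType) (k : nat) (z : R) : z != 1 ->
  k = 0%N \/ z != 0 -> E_sum k z = ((z ^+ 2)^-1 ^+ k - 1) / (1 - z).
Proof.
move=> z1 hz; have z1' : 1 - z != 0 by rewrite subr_eq0 eq_sym.
elim: k hz => [|k IH] hz; first by rewrite E_sum0 expr0 subrr mul0r.
case: hz => // z0; rewrite E_sumS // IH; last by right.
by rewrite (exprS _ k); move: (_ ^+ k) => t; field; rewrite ?z0 ?z1'.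
Qed.

Lemma sqE_sumS (R : realType) (k : nat) (z : R) :
  sqE_sum k.+1 z = 1 + z + E_sum k z.
Proof.
rewrite /sqE_sum /E_sum mulnS add2n big_ltn // big_ltn //.
rewrite addrA [1 + z]addrC; congr (_ + _).
rewrite big_add1 big_add1 /=; move: (2 * k).+1 => n.
by apply: eq_bigr => j _; rewrite exprnN; congr (_ ^ _); lia.
Qed.

(** Partial sums of a nonincreasing sequence are concave in their length, so
    those between two nonnegative ones are nonnegative. *)
Lemma partial_sum_ge0 {R : realType} (S delta : nat -> R) (M : nat) :
  S 0%N = 0 -> (forall k, S k.+1 = S k + delta k) ->
  (forall j k, (j <= k)%N -> delta k <= delta j) ->
  0 <= S M -> forall k, (k <= M)%N -> 0 <= S k.
Proof.
move=> S0 SS anti; elim: M => [|M IH] SM k.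
  by rewrite leqn0 => /eqP->; rewrite S0.
rewrite leq_eqVlt ltnS => /orP[/eqP->//|]; apply: IH.
have [dM|dM] := leP 0 (delta M); last by move: SM; rewrite SS; lra.
have : forall j, (j <= M)%N -> 0 <= S j; last exact.
elim=> [|j IHj] jM; first by rewrite S0.
by rewrite SS addr_ge0 ?IHj ?(le_trans dM) ?anti // ltnW.
Qed.

(** The increments [(1 + y) y^-2k - (1 + x) x^-2k] decrease with [k], because
    [|x| < 1 < y]. *)
Lemma E_diff_ge0 {R : realType} (x y : R) (M : nat) :
  -1 < x -> x < 0 -> 1 < y ->
  0 <= E_sum M y - E_sum M x ->
  forall k, (k <= M)%N -> 0 <= E_sum k y - E_sum k x.
Proof.
move=> x1 x0 y1.
have y0 : y != 0 by lra.
have xn0 : x != 0 by rewrite lt_eqF.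
pose delta k := (1 + y) * (y ^+ 2)^-1 ^+ k.+1 - (1 + x) * (x ^+ 2)^-1 ^+ k.+1.
apply: (@partial_sum_ge0 R (fun k => E_sum k y - E_sum k x) delta).
- by rewrite !E_sum0 subrr.
- by move=> k; rewrite !E_sumS // /delta; ring.
move=> j k jk; rewrite /delta lerB // ler_wpM2l //; try lra.
  rewrite ler_wiXn2l // ?invr_ge0 ?sqr_ge0 //.
  by rewrite invf_le1 ?exprn_gt0 ?exprn_ege1 ?ltW //; lra.
have x20 : 0 < x ^+ 2 by rewrite exprn_even_gt0.
have x21 : x ^+ 2 <= 1 by nra.
by rewrite ler_weXn2l // invf_ge1.
Qed.

Lemma rate_denominators {R : realType} {l u : R} : 1 <= l -> l < 2 -> u < 0 ->
  1 - (1 - u) ^+ 2 < 0 /\ 0 < 1 - (1 - l) ^+ 2.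
Proof. by move=> l1 l2 u0; split; nra. Qed.

Lemma tight_rateE {R : realType} (l u : R) (M : nat) :
  tight_rate M.+1 l u =
  ((2 - l + E_sum M (1 - l)) / (1 - (1 - l) ^+ 2) -
   (2 - u + E_sum M (1 - u)) / (1 - (1 - u) ^+ 2)) /
  ((1 - (1 - l) ^+ 2)^-1 - (1 - (1 - u) ^+ 2)^-1).
Proof.
rewrite /tight_rate !sqE_sumS !div1r.
by rewrite !addrA.
Qed.

(** The tight rate is the average of [E_N (1 - l)] and [E_N (1 - u)] with the
    weights [x^2 / (1 - x^2)] and [y^2 / (y^2 - 1)], both nonnegative. *)
Lemma tight_rate_le_E_sum {R : realType} (l u : R) (N : nat) :
  1 < l -> l < 2 -> u < 0 ->
  E_sum N (1 - u) < E_sum N (1 - l) ->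
  tight_rate N l u <= E_sum N (1 - l).
Proof.
move=> l1 l2 u0 h; rewrite /tight_rate !sqE_sumE ?subr_eq0; try lra.
set x := 1 - l in h *; set y := 1 - u in h *.
have px : 0 < 1 - x ^+ 2 by rewrite /x; nra.
have py : 0 < y ^+ 2 - 1 by rewrite /y; nra.
rewrite ler_pdivrMr; last first.
  by rewrite !div1r -[1 - y ^+ 2]opprB invrN opprK addr_gt0 ?invr_gt0.
rewrite -subr_ge0.
rewrite (_ : _ - _ =
    y ^+ 2 / (y ^+ 2 - 1) * (E_sum N x - E_sum N y)); last first.
  have nx := lt0r_neq0 px; have ny := lt0r_neq0 py.
  have ny' : 1 - y ^+ 2 != 0 by rewrite -opprB oppr_eq0.
  by field; rewrite nx ny ny'.
by rewrite mulr_ge0 ?divr_ge0 ?sqr_ge0 1?ltW // subr_gt0.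
Qed.

Lemma sum_E_sum {R : realType} (z : R) (M : nat) :
  z != 1 -> z != -1 -> M = 0%N \/ z != 0 ->
  \sum_(1 <= k < M.+1) E_sum k z =
  (((z ^+ 2)^-1 ^+ M - 1) / (1 - z ^+ 2) - M%:R) / (1 - z).
Proof.
move=> z1 zN1 hz.
have h1 : 1 - z != 0 by rewrite subr_eq0 eq_sym.
have h2 : 1 - z ^+ 2 != 0.
  rewrite (_ : 1 - z ^+ 2 = (1 - z) * (1 - - z)); last by ring.
  by rewrite mulf_neq0 // subr_eq0 eq_sym eqr_oppLR.
elim: M hz => [|M IH] hz.
  by rewrite big_geq // expr0 subrr mul0r subr0 mul0r.
case: hz => // z0; rewrite big_nat_recr // IH; last by right.
rewrite E_sum_closed //; last by right.
rewrite /= (exprS _ M) -natr1; move: (_ ^+ M) => t.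
by field; rewrite ?z0 ?h1 ?h2.
Qed.

(** The sign hypotheses turn the positive part at [k] into [E_k y - E_k x] for
    [k <= M] and into zero for [k = M + 1]; summing geometric series twice
    leaves a rational identity in [l], [u], [x^-2M] and [y^-2M]. *)
Lemma P_rate_tight {R : realType} (l u : R) (M : nat) :
  1 <= l -> l < 2 -> u < 0 ->
  (M = 0%N \/ 1 < l) ->
  (1 < l -> 0 <= E_sum M (1 - u) - E_sum M (1 - l)) ->
  (1 < l -> E_sum M.+1 (1 - u) < E_sum M.+1 (1 - l)) ->
  P_rate M.+1 l u = tight_rate M.+1 l u.
Proof.
move=> l1 l2 u0 hM TM TN.
have lx1 : 1 - l != 1 by lra.
have lxN1 : 1 - l != -1 by lra.
have uy1 : 1 - u != 1 by lra.
have uyN1 : 1 - u != -1 by lra.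
have hy k : k = 0%N \/ 1 - u != 0 by right; lra.
have hx : M = 0%N \/ 1 - l != 0 by case: hM => [|h]; [left|right; lra].
have PE k : 1 < l -> (0 < k)%N ->
    P_term k l u = Num.max 0 (E_sum k (1 - u) - E_sum k (1 - l)).
  move=> lgt1 k0; have hxk : k = 0%N \/ 1 - l != 0 by right; lra.
  rewrite /P_term leNgt lgt1 /= !E_sum_closed //.
  rewrite !exprVn -!exprM; congr (Num.max _ _).
  by rewrite ![-1 + _]addrC !opprB ![1 + (_ - 1)]addrC !subrK.
have sumP : \sum_(1 <= k < M.+2) P_term k l u =
    \sum_(1 <= k < M.+1) E_sum k (1 - u) - \sum_(1 <= k < M.+1) E_sum k (1 - l).
  rewrite big_nat_recr //= -sumrB.
  have [lgt1|lle1] := ltP 1 l.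
    rewrite PE // max_l ?addr0; last by rewrite subr_le0 ltW // TN.
    apply: eq_big_nat => k /andP[k0 kM]; rewrite PE // max_r //.
    by apply: (@E_diff_ge0 R _ _ M) => //; try lra; exact: TM.
  case: hM => [->|]; last by lra.
  by rewrite !big_geq // /P_term lle1 addr0.
rewrite /P_rate sumP !sum_E_sum // tight_rateE !E_sum_closed //.
rewrite /p_coef ler0_norm; last by lra.
set X := _ ^+ M; set Y := _ ^+ M.
rewrite -[in LHS]natr1.
have [d1 d2] := rate_denominators l1 l2 u0.
have d3 : 1 - (1 - u) ^+ 2 + -1 * (1 - (1 - l) ^+ 2) < 0 by lra.
field; rewrite (ltr0_neq0 d1) (lt0r_neq0 d2) (ltr0_neq0 d3) /=.
by do ?[apply/andP; split]; lra.
Qed.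

(** With [p = x^2] and [q = y^2], [G i] is the squared gradient norm at step
    [i]. The weights are chosen so that [G M = G M.+1]. *)
Lemma energy_ge {R : realType} (p q : R) (M : nat) :
  0 <= p -> p <= 1 -> 1 <= q ->
  let G i := p ^+ i * (q ^+ M * (q - 1)) + q ^+ i * (p ^+ M * (1 - p)) in
  forall i, (i <= M.+1)%N -> G M.+1 <= G i.
Proof.
move=> p0 p1 q1 G i.
have step j : (j <= M)%N -> G j.+1 <= G j.
  move=> jM; rewrite -subr_ge0.
  have -> : G j - G j.+1 =
      (q - 1) * (1 - p) * (p ^+ j * q ^+ j) * (q ^+ (M - j) - p ^+ (M - j)).
    rewrite /G -{1 2 3 4}(subnKC jM) !exprD !exprS.
    by move: (p ^+ j) (q ^+ j) (p ^+ (M - j)) (q ^+ (M - j)) => *; ring.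
  have h : p ^+ (M - j) <= q ^+ (M - j).
    by apply: (le_trans (exprn_ile1 _ p0 p1)); exact: exprn_ege1.
  by rewrite !mulr_ge0 ?subr_ge0 ?exprn_ge0 // (le_trans ler01).
(* Descend from the last step, since [step] only holds for indices up to [M]. *)
have down k : (k <= M.+1)%N -> G M.+1 <= G (M.+1 - k)%N.
  elim: k => [|k IH] kM; first by rewrite subn0.
  apply: (le_trans (IH (ltnW kM))); rewrite -(subnSK kM) step //; lia.
by move=> iM; rewrite -(subKn iM) down // leq_subr.
Qed.

(** With squared gradient components [A] and [B] at the start, the left side is
    [2 L] times the gap between the initial value and the infimum: an [L]
    quadratic in the first coordinate, a [mu] quadratic followed by a final
    [L] descent in the second. *)
Lemma tight_value {R : realType} (l u : R) (M : nat) :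
  1 <= l -> l < 2 -> u < 0 ->
  (M = 0%N \/ 1 < l) ->
  let p := (1 - l) ^+ 2 in let q := (1 - u) ^+ 2 in
  let A := q ^+ M * (q - 1) in let B := p ^+ M * (1 - p) in
  A + l / u * B * (1 - q ^+ M.+1) + B * q ^+ M.+1 =
  (p ^+ M.+1 * A + q ^+ M.+1 * B) * (1 + l * tight_rate M.+1 l u).
Proof.
move=> l1 l2 u0 hM p q A B.
have hx : M = 0%N \/ 1 - l != 0 by case: hM => [|h]; [left|right; lra].
have lx1 : 1 - l != 1 by lra.
have uy1 : 1 - u != 1 by lra.
have hy : M = 0%N \/ 1 - u != 0 by right; lra.
have P0 : p ^+ M != 0.
  by case: hx => [->|?]; rewrite ?expr0 ?oner_eq0 // !expf_neq0.
have Q0 : q ^+ M != 0 by rewrite !expf_neq0 //; lra.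
rewrite tight_rateE !E_sum_closed // !exprVn -/p -/q /A /B !exprS.
move: (p ^+ M) (q ^+ M) P0 Q0 => P Q P0 Q0.
have [d1 d2] := rate_denominators l1 l2 u0.
have d3 : 1 - (1 - u) ^+ 2 + -1 * (1 - (1 - l) ^+ 2) < 0 by lra.
rewrite /p /q; field.
rewrite (ltr0_neq0 d1) (lt0r_neq0 d2) (ltr0_neq0 d3) P0 Q0 /=.
by do ?[apply/andP; split]; lra.
Qed.

(** * Attaining the bound *)

Lemma min_sqgrad_last (R : realType) (d : nat) (f : 'rV[R]_d -> R) (gamma : R)
    (x0 : 'rV[R]_d) (N : nat) :
  (forall i, (i <= N)%N ->
    sqnorm2 (gradient f (gd_iter f gamma x0 N)) <=
    sqnorm2 (gradient f (gd_iter f gamma x0 i))) ->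
  min_sqgrad f gamma x0 N = sqnorm2 (gradient f (gd_iter f gamma x0 N)).
Proof.
move=> h; rewrite /min_sqgrad; apply/eqP; rewrite eq_le; apply/andP; split.
  exact: (bigmin_le _ (@ord_max N)).
by apply: le_bigmin => [|i _]; [exact: (h 0%N)|apply: h; rewrite -ltnS].
Qed.

(** Normalized stepsize one forces [M = 0], where both rates avoid the undefined
    [E_k 0]; otherwise [Nbar] provides the signs needed to resolve the positive
    parts and the minimum. *)
Lemma weakly_convex_rate_tight (R : realType) (l u kappa : R) (M : nat) :
  1 <= l -> l < 2 -> u < 0 -> kappa * l = u -> is_Nbar l kappa M ->
  (M = 0%N \/ 1 < l) /\ weakly_convex_rate M.+1 l u = tight_rate M.+1 l u.
Proof.
move=> l1 l2 u0 kl [TM TN].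
have TdE k : T_diff k l kappa = E_sum k (1 - u) - E_sum k (1 - l).
  by rewrite /T_diff kl.
have hM : M = 0%N \/ 1 < l.
  by case: TM => [|[ln1 _]]; [left|right; rewrite lt_neqAle eq_sym ln1].
have TM0 : 1 < l -> 0 <= E_sum M (1 - u) - E_sum M (1 - l).
  by case: TM => [-> _|[_]]; rewrite ?E_sum0 ?subrr // TdE.
have TN0 : 1 < l -> E_sum M.+1 (1 - u) < E_sum M.+1 (1 - l).
  move=> lgt1; rewrite ltNge; apply/negP => h.
  have : (M.+1 <= M)%N; last by rewrite ltnn.
  by apply: TN; right; rewrite TdE subr_ge0 h gt_eqF.
split=> //; have PT := P_rate_tight l u M l1 l2 u0 hM TM0 TN0.
rewrite /weakly_convex_rate PT; case: eqVneq => // ln1.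
have lgt1 : 1 < l by rewrite lt_neqAle eq_sym ln1.
have -> : (-1 + (1 - l) ^- (2 * M.+1)) / l = E_sum M.+1 (1 - l).
  rewrite E_sum_closed; [|lra|right; lra].
  by rewrite exprVn -exprM [-1 + _]addrC opprB [1 + (_ - 1)]addrC subrK.
by rewrite min_l // tight_rate_le_E_sum // TN0.
Qed.

Lemma valley_tight (R : realType) (d : nat) (L mu gamma : R) (M : nat) :
  0 < L -> mu < 0 -> 1 <= gamma * L -> gamma * L < 2 ->
  M = 0%N \/ 1 < gamma * L ->
  exists (x0 : 'rV[R]_d.+2) (c : R), let f := valley mu L c in
    [/\ 0 <= c, inf (range f) < f x0 &
        f x0 - inf (range f) = 1 / (2 * L) * min_sqgrad f gamma x0 M.+1 *
          (1 + gamma * L * tight_rate M.+1 (gamma * L) (gamma * mu))].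
Proof.
move=> L0 mu0 l1 l2 hM.
have g0 : 0 < gamma by rewrite -(pmulr_lgt0 _ L0) (lt_le_trans _ l1).
have u0 : gamma * mu < 0 by rewrite pmulr_rlt0.
have Ln : L != 0 by rewrite gt_eqF.
have mun : mu != 0 by rewrite lt_eqF.
pose p := (1 - gamma * L) ^+ 2; pose q := (1 - gamma * mu) ^+ 2.
have [q1 p1] := rate_denominators l1 l2 u0.
have {}q1 : 0 < q - 1 by rewrite /q; lra.
have {}p1 : 0 < 1 - p by [].
have p0 : 0 <= p by apply: sqr_ge0.
have q0 : 0 < q by lra.
pose A := q ^+ M * (q - 1); pose B := p ^+ M * (1 - p).
have A0 : 0 < A by apply: mulr_gt0 => //; exact: exprn_gt0.
have B0 : 0 <= B by apply: mulr_ge0; [exact: exprn_ge0|exact: ltW].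
(* [a] and [b] make [A] and [B] the squared gradient components at the start. *)
pose a := Num.sqrt A / L; pose b := Num.sqrt B / - mu.
have aE : L ^+ 2 * a ^+ 2 = A.
  by rewrite /a expr_div_n (sqr_sqrtr (ltW A0)) mulrC divfK ?expf_neq0.
have bE : mu ^+ 2 * b ^+ 2 = B.
  by rewrite /b expr_div_n sqrrN (sqr_sqrtr B0) mulrC divfK ?expf_neq0.
have b0 : 0 <= b by rewrite divr_ge0 ?sqrtr_ge0 // oppr_ge0 ltW.
(* The well leaves its concave part exactly at the last iterate. *)
pose c := (1 - gamma * mu) ^+ M.+1 * b.
have y0 : 0 <= 1 - gamma * mu by lra.
have c0 : 0 <= c by rewrite mulr_ge0 ?exprn_ge0.
have cE : mu ^+ 2 * c ^+ 2 = B * q ^+ M.+1.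
  by rewrite -bE /c /q exprMn -!exprM mulnC; ring.
exists (plane_vec a b), c => f.
have [_ infE] := valley_inf R d mu L c L0 (ltW mu0) c0.
have it := gd_iter_valley R d mu L gamma c a b M.+1
  L0 (ltW mu0) (ltW g0) b0 (lexx _).
have GE i : (i <= M.+1)%N ->
    sqnorm2 (gradient f (gd_iter f gamma (plane_vec a b) i)) =
      p ^+ i * A + q ^+ i * B.
  move=> iM; have [-> ->] := it i iM; rewrite sqnorm2_plane -aE -bE /p /q.
  by rewrite -!exprM mulnC !exprM; ring.
have minE : min_sqgrad f gamma (plane_vec a b) M.+1 =
    p ^+ M.+1 * A + q ^+ M.+1 * B.
  rewrite min_sqgrad_last ?GE // => i iM; rewrite !GE //.
  by apply: energy_ge => //; lra.
have bc : - c <= b <= c.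
  rewrite (le_trans _ b0) ?oppr_le0 //= /c ler_peMl // exprn_ege1 //; lra.
have fE : f (plane_vec a b) = L / 2 * a ^+ 2 + mu / 2 * b ^+ 2.
  by rewrite /f /valley !mxE /= well_inside.
split=> //.
  rewrite infE -[ltLHS]add0r ltr_leD //; last first.
    by rewrite !mxE /=; apply: well_min_le => //; exact: ltW.
  rewrite !mxE /= mulr_gt0 ?divr_gt0 // /a exprn_gt0 // divr_gt0 //.
  by rewrite sqrtr_gt0.
rewrite minE -mulrA -(tight_value _ _ _ l1 l2 u0 hM) -/p -/q -/A -/B.
rewrite infE fE /well_min.
rewrite (_ : mu / 2 * c ^+ 2 - (mu * c) ^+ 2 / (2 * L) =
   (mu ^+ 2 * c ^+ 2) / (2 * mu) - (mu ^+ 2 * c ^+ 2) / (2 * L)); last first.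
  by field; rewrite Ln mun.
rewrite cE (_ : L / 2 * a ^+ 2 + mu / 2 * b ^+ 2 =
   L ^+ 2 * a ^+ 2 / (2 * L) + mu ^+ 2 * b ^+ 2 / (2 * mu)); last first.
  by field; rewrite Ln mun.
rewrite aE bE; move: (q ^+ M.+1) => Q; clearbody A B.
by field; rewrite Ln mun gt_eqF.
Qed.

Theorem proposition5p12 (R : realType) (d : nat) (L mu gamma : R) (N : nat)
    (hd : (0 < d)%N) (hL : 0 < L) (hmu : mu < 0) (hN : (0 < N)%N)
    (hgamma : threshold N.-1 (mu / L) <= gamma * L < threshold N (mu / L))
    (hNbar : is_Nbar (gamma * L) (mu / L) N.-1) :
  exists (x0 : 'rV[R]_d) (f : 'rV[R]_d -> R),
    [/\ weakly_convex_smooth mu L f,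
        has_lbound (range f),
        ((1 < d)%N -> inf (range f) < f x0),
        1 / (2 * L) * min_sqgrad f gamma x0 N =
          (f x0 - inf (range f)) /
            (1 + gamma * L * weakly_convex_rate N (gamma * L) (gamma * mu)) &
        1 / (2 * L) * min_sqgrad f gamma x0 N =
          (f x0 - inf (range f)) /
            (1 + gamma * L * tight_rate N (gamma * L) (gamma * mu)) ].
Proof.
case: N hN hgamma hNbar => // M _ /= /andP[lo hi] hNbar.
have l1 : 1 <= gamma * L.
  by apply: le_trans lo; case/andP: (threshold_itv R M (mu / L)).
have l2 : gamma * L < 2.
  by apply: (lt_trans hi); case/andP: (threshold_itv R M.+1 (mu / L)).
have Ln : L != 0 by rewrite gt_eqF.
have g0 : 0 < gamma by rewrite -(pmulr_lgt0 _ hL) (lt_le_trans _ l1).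
have u0 : gamma * mu < 0 by rewrite pmulr_rlt0.
have kl : mu / L * (gamma * L) = gamma * mu by field.
have [hM ->] := weakly_convex_rate_tight R _ _ _ M l1 l2 u0 kl hNbar.
have curv0 : curvature_between mu L (fun _ : 'rV[R]_d => 0 : R) (fun=> 0).
  move=> x y; rewrite /dotp big1 => [|i _]; last by rewrite mxE mul0r.
  have : 0 <= sqnorm2 (y - x) by apply: sumr_ge0 => i _; exact: sqr_ge0.
  by move: (sqnorm2 _) => S S0; split; nra.
case: d hd curv0 => // -[|d] _ curv0.
  have [lb infE] :=
    inf_attained R _ (fun _ : 'rV[R]_1 => 0 : R) 0 (fun _ => lexx _).
  exists 0, (fun=> 0).
  have m0 : min_sqgrad (fun _ : 'rV[R]_1 => 0 : R) gamma 0 M.+1 = 0.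
    have G x : sqnorm2 (gradient (fun _ : 'rV[R]_1 => 0 : R) x) = 0.
      rewrite (gradient_curvature _ _ _ _ _ _ _ curv0) /sqnorm2 big1 // => i _.
      by rewrite mxE expr0n.
    by rewrite min_sqgrad_last ?G // => i _; rewrite !G.
  rewrite m0 infE subrr mulr0 mul0r.
  by split=> //; exact: weakly_convex_smooth_curvature curv0.
have [x0 [c [c0 lt val]]] :=
  valley_tight R d L mu gamma M hL hmu l1 l2 hM.
have [lb _] := valley_inf R d mu L c hL (ltW hmu) c0.
have eqn : 1 / (2 * L) * min_sqgrad (valley mu L c) gamma x0 M.+1 =
    (valley mu L c x0 - inf (range (valley mu L c : 'rV[R]_d.+2 -> R))) /
    (1 + gamma * L * tight_rate M.+1 (gamma * L) (gamma * mu)).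
  (* A vanishing denominator would contradict the strict gap. *)
  rewrite val mulfK //; apply: contraTneq lt => h.
  by rewrite -subr_gt0 val h mulr0 ltxx.
exists x0, (valley mu L c); split=> //.
apply: weakly_convex_smooth_curvature.
exact: valley_curvature R d mu L c (ltW hL) (ltW hmu) c0.
Qed.
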